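(* Let $N$ be some large integer. Let $X_0$ be distributed uniformly in $\{0,1,2,\dots,N-1\}$ and, for any $i\geq 1$, let $X_i$ be equal to $X_{i-1}+\zeta_i$ computed modulo $N$, where the $\zeta_i$ are independent (of each other and of $X_0$) and each $\zeta_i$ is $1$ or $-1$ with probability $\tfrac12$ each. The Markov chain $X_0,X_1,\dots$ is stationary and reversible. Label each state by its own value in $\{0,1,\dots,N-1\}$. If $N$ is chosen large relative to $k$, then with probability arbitrarily close to $1$, the value of $X_0$ is at distance greater than $k$ from $0$ (in both directions, modulo $N$). Conditioning on this event, $X_0$ is the (strict) minimum among $X_0,\dots,X_k$ if and only if all the partial sums $\sum_{i=1}^{j}\zeta_i$ ($1\le j\le k$) are positive, and for $k$ even the probability of this is $$\frac{1}{2^{k+1}}\binom{k}{k/2}\sim\frac{1}{\sqrt{2\pi k}}.$$ Since being the minimum out of $X_0,\dots,X_k$ corresponds to being an $\varepsilon$-outlier for $\varepsilon=\tfrac{1}{k+1}$, this example shows that, for a stationary reversible Markov chain, the probability that $X_0$ is an $\varepsilon$-outlier among $X_0,\dots,X_k$ can be as high as $\sqrt{\varepsilon/(2\pi)}$.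
   Context: A Markov chain $X_0,X_1,\dots$ is stationary if the distribution of $X_0$ is a stationary distribution (so all $X_i$ have the same distribution). A stationary chain is reversible if for all $i,k$ the sequence $(X_i,X_{i+1},\dots,X_{i+k})$ is identical in distribution to $(X_{i+k},X_{i+k-1},\dots,X_i)$. A real number $\alpha_0$ is an $\varepsilon$-outlier among $\alpha_0,\alpha_1,\dots,\alpha_k$ if there are at most $\varepsilon(k+1)$ indices $i\in\{0,1,\dots,k\}$ for which $\alpha_i\leq\alpha_0$ (the index $i=0$ is counted); a state is an $\varepsilon$-outlier if its label is. Here $\pi$ denotes the usual constant $3.14159\dots$, and $a_k\sim b_k$ means $a_k/b_k\to1$ as $k\to\infty$. *)

(* Defs.v *)
From HB Require Import structures.
From mathcomp Require Export all_boot all_order all_algebra.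
From mathcomp Require Export all_classical all_reals all_analysis.
Set Implicit Arguments.
Unset Strict Implicit.
Unset Printing Implicit Defensive.
Import Order.TTheory GRing.Theory Num.Theory.
Import numFieldNormedType.Exports.

Local Open Scope classical_set_scope.
Local Open Scope ring_scope.

Section discrete_probability.
Context {R : realType} {d : measure_display} {T : measurableType d}.
Variable P : probability T R.

Definition pr (A : set T) : R := fine (P A).

(* Junk value 0 when pr B = 0, since x / 0 = 0. *)
Definition cond_pr (A B : set T) : R := pr (A `&` B) / pr B.

(* S is meant to be countable and carries the discrete sigma-algebra. *)
Definition discrete_rv {S : Type} (Y : T -> S) :=
  forall A : set S, measurable (Y @^-1` A).

(* The sigma-algebra on T generated by Y, for the discrete sigma-algebra on S. *)
Definition sigma_of {S : Type} (Y : T -> S) : set (set T) :=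
  [set E | exists A : set S, E = Y @^-1` A].

Definition mutually_independent {I : eqType} (F : I -> set (set T)) :=
  forall (s : seq I) (E : I -> set T), uniq s ->
    (forall i, i \in s -> F i (E i)) ->
    pr (\bigcap_(i in [set j | j \in s]) E i) = \prod_(i <- s) pr (E i).

End discrete_probability.

Section markov_chains.
Context {R : realType} {d : measure_display} {T : measurableType d}.
Context {S : finType}.
Variables (P : probability T R) (X : nat -> T -> S).

Definition path_event (n : nat) (s : nat -> S) : set T :=
  [set w | forall i, (i <= n)%N -> X i w = s i].

(* Time-homogeneous Markov chain with transition matrix M. *)
Record markov_chain (M : S -> S -> R) : Prop := MarkovChain {
  markov_rv : forall n, discrete_rv (X n);
  markov_ge0 : forall x y, 0 <= M x y;
  markov_sum1 : forall x, \sum_y M x y = 1;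
  markov_step : forall (n : nat) (s : nat -> S) (y : S),
    0 < pr P (path_event n s) ->
    cond_pr P [set w | X n.+1 w = y] (path_event n s) = M (s n) y }.

Definition stationary_distribution (M : S -> S -> R) (mu : S -> R) : Prop :=
  [/\ forall x, 0 <= mu x,
      \sum_x mu x = 1 &
      forall y, \sum_x mu x * M x y = mu y].

Definition stationary_chain : Prop :=
  exists2 M : S -> S -> R, markov_chain M &
    stationary_distribution M (fun x => pr P [set w | X 0%N w = x]).

(* Sequences are compared as random elements of S^(k+1). *)
Definition reversible : Prop :=
  forall (i k : nat) (A : set (k.+1.-tuple S)),
    P [set w | A [tuple X (i + j)%N w | j < k.+1]] =
    P [set w | A [tuple X (i + (k - j))%N w | j < k.+1]].

Definition stationary_reversible_chain : Prop :=
  stationary_chain /\ reversible.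

End markov_chains.

Definition outlier {R : realType} (eps : R) (k : nat)
    (alpha : 'I_k.+1 -> R) : Prop :=
  #|[pred i | alpha i <= alpha ord0]|%:R <= eps * k.+1%:R.

(* zeta 0 plays no role: the increments are zeta 1, zeta 2, ...  They are only
   required to take values in {1, -1} almost surely. *)
Record cycle_walk {R : realType} {d : measure_display} {T : measurableType d}
    (N : nat) (P : probability T R) (zeta : nat -> T -> int)
    (X : nat -> T -> 'I_N) : Prop := CycleWalk {
  walk_start_rv : discrete_rv (X 0%N);
  walk_incr_rv : forall i, (0 < i)%N -> discrete_rv (zeta i);
  walk_start_uniform : forall x, pr P [set w | X 0%N w = x] = N%:R^-1;
  walk_incr_up : forall i, (0 < i)%N -> pr P [set w | zeta i w = 1] = 2^-1;
  walk_incr_down : forall i, (0 < i)%N -> pr P [set w | zeta i w = -1] = 2^-1;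
  walk_independent : mutually_independent P
    (fun i : nat => if i is 0%N then sigma_of (X 0%N) else sigma_of (zeta i));
  walk_step : forall i w,
    (X i.+1 w)%:Z = (((X i w)%:Z + zeta i.+1 w) %% N%:Z)%Z }.

Definition value_label {R : realType} (N : nat) (x : 'I_N) : R := (x : nat)%:R.

(* Cyclic distance from x to 0 greater than k, going down or going up. *)
Definition far_from_0 (k N : nat) (x : 'I_N) : Prop :=
  (k < x)%N /\ (k < N - x)%N.

Definition strict_min_at_0 (k N : nat) (x : nat -> 'I_N) : Prop :=
  forall j, (0 < j <= k)%N -> (x 0%N < x j)%N.

Definition positive_partial_sums (k : nat) (z : nat -> int) : Prop :=
  forall j, (0 < j <= k)%N -> 0 < \sum_(1 <= i < j.+1) z i.

Definition ballot_pr {R : realType} (k : nat) : R :=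
  (2 ^+ k.+1)^-1 * 'C(k, k./2)%:R.

(* Main.v *)
Require Import Defs.
From HB Require Import structures.
From mathcomp Require Import all_boot all_order all_algebra.
From mathcomp Require Import all_classical all_reals all_analysis.
From mathcomp Require Import zify ring lra.
Set Implicit Arguments.
Unset Strict Implicit.
Unset Printing Implicit Defensive.
Import Order.TTheory GRing.Theory Num.Theory.
Import numFieldNormedType.Exports.
Local Open Scope classical_set_scope.
Local Open Scope ring_scope.

(** Up to a null set, everything about X_0, ..., X_n is a function of X_0 and of
    the signs of zeta_1, ..., zeta_n, and these N 2^n configurations are
    equiprobable, so every probability is a counting problem.  Reversibility
    is the bijection of configurations that runs a window of the path
    backwards.  Far from 0 the walk does not wrap around within k steps, so
    the strict minimum event is the positivity of the partial sums, counted by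
    the reflection principle: C(2m, m) / 2 of the 2^(2m) sign sequences.

    With a_m := C(2m, m) / 4^m and W_n the Wallis integral of cos^n over
    [0, pi/2], one has W_(2m) = (pi/2) a_m and (n+1) W_n W_(n+1) = pi/2, and
    since W is strictly decreasing, 2 / (2m+1) < pi a_m^2 <= 1 / m.  This gives
    the asymptotics, and the strict lower bound leaves room for the
    probability that X_0 is close to 0.

    The walk exists on [0, 1] with Lebesgue measure: if U is uniform, take X_0
    to be the integer part of N U and the signs to be the binary digits of its
    fractional part, i.e. the parities of the integer parts of N 2^i U. *)

(** * Counting walks with positive partial sums *)

Lemma sum_tuple_cons (T : finType) n (F : n.+1.-tuple T -> nat) :
  (\sum_e F e = \sum_b \sum_e F (cons_tuple b e))%N.
Proof.
rewrite pair_big /= (reindex (fun p : T * n.-tuple T => cons_tuple p.1 p.2)) //.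
exists (fun e => (thead e, behead_tuple e)) => [[b e] _|e _] /=.
- by congr pair; apply/val_inj.
- by apply/val_inj; rewrite /= [in RHS](tuple_eta e).
Qed.

Definition sgn_of (b : bool) : int := if b then 1 else -1.

(** Positions past the end of [s] read as [false], that is, as steps -1. *)
Definition psum (s : seq bool) (j : nat) : int :=
  \sum_(i < j) sgn_of (nth false s i).

Lemma psum0 s : psum s 0 = 0.
Proof. by rewrite /psum big_ord0. Qed.

Lemma psum_cons b s j : psum (b :: s) j.+1 = sgn_of b + psum s j.
Proof. by rewrite /psum big_ord_recl. Qed.

Lemma psumS s j : psum s j.+1 = psum s j + sgn_of (nth false s j).
Proof. by rewrite /psum big_ord_recr. Qed.

Lemma sgn_of_norm b : `|sgn_of b| = 1.
Proof. by case: b. Qed.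

Lemma psum_norm_le s j : `|psum s j| <= j%:Z.
Proof.
elim: j => [|j IH]; first by rewrite psum0.
rewrite psumS; apply: (le_trans (ler_normD _ _)).
by rewrite sgn_of_norm; lia.
Qed.

Fixpoint stay (a : int) (s : seq bool) : bool :=
  (0 <= a) && (if s is b :: s' then stay (a + sgn_of b) s' else true).

Lemma stayP a s :
  reflect (forall j, (j <= size s)%N -> 0 <= a + psum s j) (stay a s).
Proof.
elim: s a => [|b s IH] a /=.
  rewrite andbT; apply: (iffP idP) => [a0 j|/(_ 0%N)].
    by rewrite leqn0 => /eqP ->; rewrite psum0 addr0.
  by rewrite psum0 addr0; apply.
apply: (iffP andP) => [[a0 /IH H] [|j] js|H].
- by rewrite psum0 addr0.
- by rewrite psum_cons addrA; apply: H.
- split; first by have := H 0%N; rewrite psum0 addr0; apply.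
  by apply/IH => j js; rewrite -addrA -psum_cons; apply: H.
Qed.

(* The reflection principle, in the form that both sides satisfy the same
   recurrence in n; a = -1 is its boundary case, where both vanish. *)
Lemma count_stay n (a : int) : -1 <= a ->
  (\sum_(e : n.-tuple bool) stay a e =
   \sum_(e : n.-tuple bool) ((- a <= psum e n <= a + 1)%R : bool))%N.
Proof.
elim: n a => [|n IH] a a1.
  apply: eq_bigr => e _; rewrite tuple0 /= psum0; congr (nat_of_bool _).
  by lia.
have [a0|a0] := leP 0 a; last first.
  rewrite !big1 // => e _; apply/eqP; rewrite eqb0.
    by lia.
  by case: e => -[|b s] _ /=; rewrite negb_and; lia.
rewrite !sum_tuple_cons !big_bool /=.
under eq_bigr do rewrite a0 /=.
rewrite [X in (_ + X)%N](eq_bigr (fun e : n.-tuple bool => stay (a - 1) e : nat));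
  last by move=> e _; rewrite a0.
rewrite !IH; try lia.
(* For [a >= 0] the intervals [-a-1, a+2] and [1-a, a] are the union and the intersection of
   [-a-1, a] and [1-a, a+2], so the indicators have equal sums. *)
rewrite -!big_split /=; apply: eq_bigr => e _.
rewrite !psum_cons /=.
set x := psum _ _; rewrite /sgn_of.
lia.
Qed.

(** [j] counts the down steps, so splitting off the first step is Pascal's rule. *)
Lemma count_psum_eq n j :
  (\sum_(e : n.-tuple bool) ((psum e n == n%:Z - j%:Z *+ 2)%R : bool) = 'C(n, j))%N.
Proof.
elim: n j => [|n IH] j.
  rewrite (big_pred1 [tuple]); last by move=> e; apply/esym/eqP; exact: tuple0.
  by rewrite psum0 bin0n; congr (nat_of_bool _); lia.
rewrite sum_tuple_cons big_bool /=.
under eq_bigr do rewrite psum_cons.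
under [X in (_ + X)%N]eq_bigr do rewrite psum_cons.
case: j => [|j].
  rewrite [X in (_ + X)%N]big1 ?addn0 => [|e _]; last first.
    have := psum_norm_le e n; set x := psum _ _ => hx.
    by apply/eqP; rewrite eqb0 /sgn_of; lia.
  rewrite bin0 -(bin0 n) -IH; apply: eq_bigr => e _.
  by congr nat_of_bool; rewrite /sgn_of; lia.
rewrite binS -!IH; congr addn; apply: eq_bigr => e _.
  by congr nat_of_bool; rewrite /sgn_of; lia.
by congr nat_of_bool; rewrite /sgn_of; lia.
Qed.

Definition all_pos k (s : seq bool) : bool :=
  [forall j : 'I_k, 0 < psum s j.+1].

Lemma all_posP k s :
  reflect (forall j, (0 < j <= k)%N -> 0 < psum s j) (all_pos k s).
Proof.
apply: (iffP forallP) => [H [//|j] jk|H j].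
  exact: (H (Ordinal (jk : (j < k)%N))).
by apply: H; rewrite ltn_ord.
Qed.

(** The first step must go up to 1; from there, staying positive means never falling below the
    height 0 of the shifted walk. *)
Lemma all_pos_cons n b (e : n.-tuple bool) :
  all_pos n.+1 (b :: e) = b && stay 0 e.
Proof.
apply/all_posP/andP => [H|[-> /stayP H] [//|j] /= jn].
  have := H 1%N isT; rewrite psum_cons psum0; case: b H => // H _; split=> //.
  apply/stayP => j; rewrite size_tuple => jn.
  by have := H j.+1 jn; rewrite psum_cons /sgn_of; lia.
have := H j; rewrite size_tuple psum_cons /sgn_of => /(_ jn); lia.
Qed.

(** The reflection principle leaves the paths of length 2m+1 ending at 1, in number C(2m+1, m); by
    symmetry of the row, twice this is C(2m+2, m+1). Length 0 is excluded: positivity is vacuous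
    there and the count is 1, not 1/2. *)
Lemma count_all_pos m :
  ((\sum_(e : m.+1.*2.-tuple bool) all_pos m.+1.*2 e).*2 = 'C(m.+1.*2, m.+1))%N.
Proof.
rewrite doubleS sum_tuple_cons big_bool /=.
rewrite [X in (_ + X)%N]big1 ?addn0 => [|e _]; last by rewrite all_pos_cons.
under eq_bigr do rewrite all_pos_cons /=.
rewrite count_stay //.
rewrite (eq_bigr (fun e : m.*2.+1.-tuple bool =>
   ((psum e m.*2.+1 == m.*2.+1%:Z - m%:Z *+ 2)%R : bool) : nat)); last first.
  move=> e _; congr nat_of_bool.
  (* of the two admissible endpoints, only 1 has the parity of the length *)
  have parity n : exists c : int, psum e n = c *+ 2 + n%:Z.
    elim: n => [|n [c IH]]; first by exists 0; rewrite psum0.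
    rewrite psumS IH; case: nth; [exists c|exists (c - 1)]; rewrite /sgn_of; lia.
  by have [c ->] := parity m.*2.+1; lia.
rewrite count_psum_eq -addnn binS; congr addn.
rewrite -[LHS]bin_sub; last lia.
by congr binomial; lia.
Qed.

(** * Wallis integrals and the central binomial coefficient *)

Section wallis.
Variable R : realType.

(* A primitive of cos^(n+2) is (cos^(n+1) sin + (n+1) F_n) / (n+2), with F_n one
   of cos^n; the pair holds two consecutive primitives vanishing at 0. *)
Fixpoint cosX_primitive_pair (n : nat) : (R -> R) * (R -> R) :=
  if n is n'.+1 then
    let: (f, g) := cosX_primitive_pair n' in
    (g, fun x => n'.+2%:R^-1 * (cos x ^+ n'.+1 * sin x + n'.+1%:R * f x))
  else (id, sin).

Definition cosX_primitive n := (cosX_primitive_pair n).1.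

Lemma cosX_primitiveSS n x :
  cosX_primitive n.+2 x =
  n.+2%:R^-1 * (cos x ^+ n.+1 * sin x + n.+1%:R * cosX_primitive n x).
Proof. by rewrite /cosX_primitive /=; case: cosX_primitive_pair. Qed.

Lemma cosX_primitive_at0 n : cosX_primitive n 0 = 0.
Proof.
suff: cosX_primitive n 0 = 0 /\ cosX_primitive n.+1 0 = 0 by case.
elim: n => [|n [IH IH']]; first by rewrite /cosX_primitive /= sin0.
by split=> //; rewrite cosX_primitiveSS IH sin0 !(mulr0, addr0).
Qed.

Lemma is_derive_cosX_primitive n (x : R) :
  is_derive x 1 (cosX_primitive n) (cos x ^+ n).
Proof.
suff: is_derive x 1 (cosX_primitive n) (cos x ^+ n) /\
      is_derive x 1 (cosX_primitive n.+1) (cos x ^+ n.+1) by case.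
elim: n => [|n [IH IH']].
  split; first by rewrite expr0; exact: is_derive_id.
  by rewrite expr1; exact: is_derive_sin.
split=> //.
have -> : cosX_primitive n.+2 =
    n.+2%:R^-1 \*: ((cos ^+ n.+1) * sin + n.+1%:R \*: cosX_primitive n).
  by apply/funext => y; rewrite cosX_primitiveSS !fctE /GRing.scale /=.
apply: is_derive_eq.
have s2 : sin x ^+ 2 = 1 - cos x ^+ 2 by rewrite -(cos2Dsin2 x) addrC addKr.
have n0 : n.+2%:R != 0 :> R by rewrite pnatr_eq0.
rewrite !fctE /= !scaler_nat /GRing.scale /=.
apply: (mulfI n0); rewrite mulVKf // -(mulr_natr (cos x ^+ n)).
rewrite !exprS in s2 *.
ring: s2.
Qed.

(** The primitive vanishes at 0, so its value at pi/2 is the integral over [0, pi/2]. *)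
Definition wallis_integral n := cosX_primitive n (pi / 2).

Local Notation W := wallis_integral.

Lemma wallis_integral0 : W 0 = pi / 2.
Proof. by []. Qed.

Lemma wallis_integral1 : W 1 = 1.
Proof. exact: sin_pihalf. Qed.

Lemma wallis_integralSS n : n.+2%:R * W n.+2 = n.+1%:R * W n.
Proof.
rewrite /W cosX_primitiveSS cos_pihalf expr0n mul0r add0r mulVKf //.
Qed.

Lemma wallis_integral_gt0 n : 0 < W n.
Proof.
suff: 0 < W n /\ 0 < W n.+1 by case.
elim: n => [|n [IH IH']].
  by rewrite wallis_integral0 wallis_integral1; have := pi_gt0 R; split; lra.
split=> //; rewrite -(@pmulr_rgt0 _ n.+2%:R) ?ltr0n // wallis_integralSS.
by rewrite pmulr_rgt0 ?ltr0n.
Qed.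

(** The difference of the two primitives has derivative cos^n (1 - cos), which is positive on the
    open interval. *)
Lemma wallis_integral_decr n : W n.+1 < W n.
Proof.
pose f : R -> R := cosX_primitive n - cosX_primitive n.+1.
have df (x : R) : is_derive x 1 f (cos x ^+ n - cos x ^+ n.+1).
  by apply: is_deriveB; exact: is_derive_cosX_primitive.
have pi0 := pi_gt0 R.
suff: f 0 < f (pi / 2).
  by rewrite /f !fctE !cosX_primitive_at0 subrr subr_gt0.
apply: (@gtr0_derive1_lt_cc _ f 0 (pi / 2)); rewrite ?in_itv /= ?lexx; try lra.
- by move=> x _; exact: ex_derive.
- move=> x; rewrite in_itv /= => /andP[x0 x1].
  rewrite derive1E; case: (df x) => _ ->.
  rewrite exprS -{1}(mul1r (cos x ^+ n)) -mulrBl.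
  rewrite mulr_gt0 ?exprn_gt0 ?cos_gt0_pihalf ?subr_gt0 //; last lra.
  by rewrite -[ltRHS]cos0 ltr_cos // in_itv /=; lra.
- apply: derivable_within_continuous => x _; exact: ex_derive.
Qed.

(** By the two-step recurrence the left side does not depend on [n]; at [n = 0] it is W_0 W_1. *)
Lemma wallis_integralM n : n.+1%:R * (W n * W n.+1) = pi / 2.
Proof.
elim: n => [|n IH]; first by rewrite wallis_integral1 mul1r mulr1.
rewrite -IH mulrCA wallis_integralSS; ring.
Qed.

Definition central_ratio m : R := 'C(m.*2, m)%:R / 4 ^+ m.

Local Notation a := central_ratio.

(** Two uses of k C(n, k) = n C(n-1, k-1), joined by C(2m+1, m+1) = C(2m+1, m). *)
Lemma central_binS m : (m.+1 * 'C(m.+1.*2, m.+1) = 2 * (m.*2.+1 * 'C(m.*2, m)))%N.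
Proof.
have e1 := mul_bin_diag m.*2.+2 m.
have e2 := mul_bin_diag m.*2.+1 m.
have e3 : 'C(m.*2.+1, m.+1) = 'C(m.*2.+1, m).
  by rewrite -[LHS]bin_sub; [congr binomial|]; lia.
rewrite /= in e1 e2; rewrite doubleS -e1 e2 -e3.
lia.
Qed.

(** Both sides satisfy the same recurrence in [m], the right one by [central_binS]. *)
Lemma wallis_integral_even m : W m.*2 = pi / 2 * a m.
Proof.
elim: m => [|m IH]; first by rewrite /a bin0 expr0 divr1 mulr1.
have m0 : m.+1%:R != 0 :> R by rewrite pnatr_eq0.
have := congr1 (fun n : nat => n%:R : R) (central_binS m).
rewrite !natrM => C.
have m20 : m.*2.+2%:R != 0 :> R by rewrite pnatr_eq0.
apply: (mulfI m20); rewrite doubleS wallis_integralSS IH /a.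
rewrite -doubleS.
have -> : 'C(m.+1.*2, m.+1)%:R = m.+1%:R^-1 * (2 * (m.*2.+1%:R * 'C(m.*2, m)%:R)) :> R.
  by rewrite -C mulKf.
have -> : m.+1.*2%:R = 2 * m.+1%:R :> R by rewrite -mul2n natrM.
rewrite exprS; field.
by rewrite nat1r m0 expf_neq0 // pnatr_eq0.
Qed.

Lemma central_ratio_gt0 m : 0 < a m.
Proof. by rewrite divr_gt0 ?exprn_gt0 ?ltr0n ?bin_gt0 //; lia. Qed.

(** Replacing one factor of W_(2m)^2 by the smaller W_(2m+1) leaves a product of known value. *)
Lemma central_ratio_lb m : 1 < pi / 2 * m.*2.+1%:R * a m ^+ 2.
Proof.
have pi0 := pi_gt0 R.
rewrite -(@ltr_pM2l _ (pi / 2)); last by lra.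
rewrite mulr1 -{1}(wallis_integralM m.*2).
have -> : pi / 2 * (pi / 2 * m.*2.+1%:R * a m ^+ 2) = m.*2.+1%:R * (W m.*2 * W m.*2).
  by rewrite wallis_integral_even; ring.
by rewrite !ltr_pM2l ?ltr0n ?wallis_integral_gt0 ?wallis_integral_decr.
Qed.

(** Here one factor of W_(2m)^2 is replaced by the larger W_(2m-1), which requires m > 0. *)
Lemma central_ratio_ub m : pi * m%:R * a m ^+ 2 <= 1.
Proof.
case: m => [|m]; first by rewrite mulr0 mul0r ler01.
have pi0 := pi_gt0 R.
rewrite -(@ler_pM2l _ (pi / 2)); last by lra.
rewrite mulr1 -{2}(wallis_integralM m.*2.+1) -doubleS.
have -> : pi / 2 * (pi * m.+1%:R * a m.+1 ^+ 2) = m.+1.*2%:R * (W m.+1.*2 * W m.+1.*2).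
  by rewrite wallis_integral_even -mul2n natrM; field.
rewrite ler_pM2l ?ltr0n // ler_pM2r ?wallis_integral_gt0 //.
by rewrite doubleS ltW // wallis_integral_decr.
Qed.

Lemma ballot_prE m : ballot_pr m.*2 = a m / 2 :> R.
Proof.
rewrite /ballot_pr doubleK exprS -mul2n exprM.
have -> : 2 ^+ 2 = 4 :> R by ring.
by rewrite /a -mul2n; field; rewrite expf_neq0 // pnatr_eq0.
Qed.

(** Squaring turns this into [central_ratio_lb]. *)
Lemma ballot_pr_gt_sqrt m :
  Num.sqrt (m.*2.+1%:R^-1 / (2 * pi)) < ballot_pr m.*2 :> R.
Proof.
have pi0 := pi_gt0 R; have a0 := central_ratio_gt0 m.
have m0 : 0 < m.*2.+1%:R :> R by rewrite ltr0n.
rewrite ballot_prE -(ger0_norm (ltW (_ : 0 < a m / 2))); last by lra.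
rewrite -sqrtr_sqr ltr_sqrt; last by rewrite exprn_gt0 //; lra.
rewrite -invfM invf_plt ?posrE; last 2 first.
- by rewrite !mulr_gt0 //; lra.
- by rewrite exprn_gt0 //; lra.
rewrite -[ltLHS]mul1r ltr_pdivrMr; last by rewrite exprn_gt0 //; lra.
by apply: lt_le_trans (central_ratio_lb m) _; rewrite le_eqVlt; apply/orP; left; apply/eqP; field.
Qed.

Lemma ballot_pr_sim :
  (fun m : nat => ballot_pr m.*2 / (Num.sqrt (2 * pi * m.*2%:R))^-1 : R)
    @ \oo --> (1 : R).
Proof.
pose u m : R := ballot_pr m.*2 / (Num.sqrt (2 * pi * m.*2%:R))^-1.
have pi0 := pi_gt0 R.
have u2 m : u m ^+ 2 = pi * m%:R * a m ^+ 2.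
  rewrite /u invrK ballot_prE exprMn sqr_sqrtr; last by rewrite !mulr_ge0 //; lra.
  by rewrite -mul2n natrM; field.
have u0 m : 0 <= u m.
  by rewrite /u invrK mulr_ge0 ?sqrtr_ge0 // ballot_prE; have := central_ratio_gt0 m; lra.
apply: (@squeeze_cvgr _ _ _ _ (fun m => 1 - m.+1%:R^-1) (fun=> 1)).
- apply: nearW => m /=; rewrite -/(u m).
  have u1 : u m <= 1.
    by rewrite -(@expr_le1 _ 2) // u2 central_ratio_ub.
  (* Since [u m] lies in [0, 1] it is at least its square, and the Wallis bound makes that square at
     least 2m/(2m+1) >= m/(m+1). *)
  rewrite u1 andbT; apply: (@le_trans _ _ (u m ^+ 2)); last first.
    by rewrite expr2 ler_piMr.
  have m0 : 0 < m.+1%:R :> R by rewrite ltr0n.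
  have m2 : 0 < m.*2.+1%:R :> R by rewrite ltr0n.
  have lb := central_ratio_lb m.
  rewrite u2.
  set x := pi * a m ^+ 2; have -> : pi * m%:R * a m ^+ 2 = x * m%:R by rewrite /x; ring.
  have {lb} : 1 < x * (2 * m%:R + 1) / 2.
    by apply: lt_le_trans lb _; rewrite -[m.*2.+1%:R]natr1 -mul2n natrM /x le_eqVlt; apply/orP; left; apply/eqP; field.
  have x0 : 0 < x by rewrite mulr_gt0 // exprn_gt0 // central_ratio_gt0.
  rewrite -[m.+1%:R]natr1 in m0 *.
  have : 0 <= m%:R :> R by [].
  move: (m%:R : R) m0 => t t1 t0 lb.
  rewrite lerBlDr -(ler_pM2r t1) mulrDl mul1r mulVf ?gt_eqF //.
  by nra.
- rewrite -[X in _ --> X]subr0; apply: cvgB; first exact: cvg_cst.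
  exact: cvg_harmonic.
- exact: cvg_cst.
Qed.

End wallis.

(** * Reduction to finitely many equiprobable configurations *)

Section pr_theory.
Context {R : realType} {d : measure_display} {T : measurableType d}.
Variable P : probability T R.

Lemma pr_fin (A : set T) : measurable A -> (pr P A)%:E = P A.
Proof. by move=> mA; rewrite /pr fineK // fin_num_measure. Qed.

Lemma pr_ge0 (A : set T) : 0 <= pr P A.
Proof. by rewrite /pr fine_ge0. Qed.

Lemma pr_setT : pr P setT = 1.
Proof. by rewrite /pr probability_setT. Qed.

Lemma pr_setU (A B : set T) : measurable A -> measurable B ->
  A `&` B = set0 -> pr P (A `|` B) = pr P A + pr P B.
Proof.
move=> mA mB AB; apply: EFin_inj; rewrite EFinD !pr_fin //.
  by rewrite measureU.
exact: measurableU.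
Qed.

Lemma pr_setC (A : set T) : measurable A -> pr P (~` A) = 1 - pr P A.
Proof.
move=> mA; apply: EFin_inj; rewrite EFinB !pr_fin //; last exact: measurableC.
exact: probability_setC.
Qed.

Lemma le_pr (A B : set T) : measurable A -> measurable B ->
  A `<=` B -> pr P A <= pr P B.
Proof. by move=> mA mB AB; rewrite -lee_fin !pr_fin // le_measure // inE. Qed.

Lemma pr_setI_bigcup (I : finType) (F : I -> set T) (A : set T) :
  (forall i, measurable (F i)) -> trivIset setT F -> measurable A ->
  pr P (A `&` \bigcup_i F i) = \sum_i pr P (A `&` F i).
Proof.
move=> mF tF mA; apply: EFin_inj.
have mAF i : measurable (A `&` F i) by exact: measurableI.
have fI : finite_set [set: I] by exact: finite_finset.
rewrite -sumEFin setI_bigcupr pr_fin; last exact: fin_bigcup_measurable.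
rewrite content_fin_bigcup //; last 2 first.
- exact: trivIset_setIl.
- exact: fin_bigcup_measurable.
have -> : [set: I] = [set` enum I].
  by apply/seteqP; split=> // i _ /=; rewrite mem_enum.
rewrite -fsbig_seq ?enum_uniq // big_enum /=.
by apply: eq_bigr => i _; rewrite pr_fin.
Qed.

(** The cells have total mass 1, so what lies outside their union is null and [A] is determined, up
    to a null set, by the cells on which it holds. *)
Lemma pr_uniform_partition (I : finType) (F : I -> set T) (A : set T) (Q : pred I) :
  (0 < #|I|)%N -> (forall i, measurable (F i)) -> trivIset setT F ->
  (forall i, pr P (F i) = #|I|%:R^-1) -> measurable A ->
  (forall i w, F i w -> A w <-> Q i) ->
  pr P A = #|Q|%:R / #|I|%:R.
Proof.
move=> I0 mF tF prF mA AQ; pose U := \bigcup_i F i.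
have mU : measurable U.
  by apply: fin_bigcup_measurable => //; exact: finite_finset.
have mCU : measurable (~` U) by exact: measurableC.
have prU : pr P U = 1.
  rewrite -[U]setTI pr_setI_bigcup //; under eq_bigr do rewrite setTI prF.
  rewrite sumr_const -[_ *+ _]mulr_natr mulVf //.
  by rewrite pnatr_eq0 -lt0n.
have -> : pr P A = pr P (A `&` U).
  have {1}-> : A = (A `&` U) `|` (A `&` ~` U) by rewrite -setIUr setUv setIT.
  rewrite pr_setU; first last.
  - by rewrite setIACA setICr setI0.
  - exact: measurableI.
  - exact: measurableI.
  rewrite (_ : pr P (A `&` ~` U) = 0) ?addr0 //; apply/le_anti.
  rewrite pr_ge0 andbT; have <- : pr P (~` U) = 0.
    by rewrite pr_setC // prU subrr.
  by apply: le_pr => //; exact: measurableI.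
rewrite pr_setI_bigcup //.
rewrite (bigID Q) /= [X in _ + X]big1 ?addr0 => [|i /negP nQ]; last first.
  rewrite (_ : A `&` _ = set0) ?/pr ?measure0 //.
  by apply/seteqP; split=> // w [Aw Fiw]; apply: nQ; apply/(AQ i w).
rewrite (eq_bigr (fun=> #|I|%:R^-1)) => [|i Qi]; last first.
  rewrite -(prF i); congr pr; apply/seteqP; split=> w; first by case.
  by move=> Fiw; split=> //; apply/(AQ i w).
by rewrite sumr_const -[_ *+ _]mulr_natl.
Qed.

End pr_theory.

Section discrete_rv_theory.
Context {d : measure_display} {T : measurableType d}.

Lemma discrete_rv_comp {S S' : Type} (Y : T -> S) (f : S -> S') :
  discrete_rv Y -> discrete_rv (f \o Y).
Proof. by move=> mY A; rewrite comp_preimage; exact: mY. Qed.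

Lemma discrete_rv_pair {S S' : Type} (Y : T -> S) (Z : T -> S') :
  countable [set: S] -> discrete_rv Y -> discrete_rv Z ->
  discrete_rv (fun w => (Y w, Z w)).
Proof.
move=> cS mY mZ A.
have -> : (fun w => (Y w, Z w)) @^-1` A =
    \bigcup_(y : S) (Y @^-1` [set y] `&` Z @^-1` [set z | A (y, z)]).
  apply/seteqP; split=> [w Aw|w [y _ [/= <- //]]].
  by exists (Y w).
by apply: countable_bigcupT_measurable => // y; exact: measurableI.
Qed.

End discrete_rv_theory.

Section cycle_shift.
Variable N : nat.

Definition cycle_shift (x : 'I_N) (z : int) : 'I_N :=
  insubd x `|((x%:Z + z) %% N%:Z)%Z|%N.

Lemma cycle_shiftE x z : (cycle_shift x z)%:Z = ((x%:Z + z) %% N%:Z)%Z.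
Proof.
have N0 : (0 < N)%N by case: N x => // -[].
rewrite /cycle_shift val_insubd.
have m0 : (0 <= (x%:Z + z) %% N%:Z)%Z by rewrite modz_ge0; lia.
have mN : ((x%:Z + z) %% N%:Z < N%:Z)%Z by rewrite ltz_pmod; lia.
by case: ifP; lia.
Qed.

Lemma cycle_shift0 x : cycle_shift x 0 = x.
Proof.
apply/val_inj/eqP; rewrite -eqz_nat cycle_shiftE addr0 modz_small //.
by have := ltn_ord x; lia.
Qed.

Lemma cycle_shiftD x y z : cycle_shift (cycle_shift x y) z = cycle_shift x (y + z).
Proof.
by apply/val_inj/eqP; rewrite -eqz_nat !cycle_shiftE modzDml addrA.
Qed.

Lemma cycle_shift_eq x y z : (cycle_shift x z == y) = (x == cycle_shift y (- z)).
Proof.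
by apply/eqP/eqP => [<-|->]; rewrite cycle_shiftD ?subrr ?addNr cycle_shift0.
Qed.

End cycle_shift.

Section walk_configurations.
Variables (N n : nat).

Definition config : finType := ('I_N * n.-tuple bool)%type.

Lemma card_config : #|{: config}| = (N * 2 ^ n)%N.
Proof. by rewrite card_prod card_ord card_tuple card_bool. Qed.

Definition config_path (c : config) (j : nat) : 'I_N :=
  cycle_shift c.1 (psum c.2 j).

Lemma config_pathS c j :
  config_path c j.+1 = cycle_shift (config_path c j) (sgn_of (nth false c.2 j)).
Proof. by rewrite /config_path cycle_shiftD psumS. Qed.

End walk_configurations.

Section cycle_walk_law.
Context {R : realType} {d : measure_display} {T : measurableType d}.
Variables (P : probability T R) (N : nat).
Variables (zeta : nat -> T -> int) (X : nat -> T -> 'I_N).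
Hypothesis cw : cycle_walk P zeta X.

(** For [N = 0] a map from [T] to an empty type forces [T] to be empty, against total mass 1. *)
Lemma cycle_walk_size_gt0 : (0 < N)%N.
Proof.
case: N X cw => // X' _; exfalso.
have T0 : [set: T] = set0 by apply/seteqP; split=> // w _; case: (X' 0%N w).
have := pr_setT P; rewrite T0 /pr measure0 => /esym/eqP.
by rewrite oner_eq0.
Qed.

Lemma walk_shift n w : X n.+1 w = cycle_shift (X n w) (zeta n.+1 w).
Proof. by apply/val_inj/eqP; rewrite -eqz_nat (walk_step cw) cycle_shiftE. Qed.

Lemma discrete_rv_walk n : discrete_rv (X n).
Proof.
elim: n => [|n IH]; first exact: walk_start_rv cw.
have -> : X n.+1 = (fun p => cycle_shift p.1 p.2) \o (fun w => (X n w, zeta n.+1 w)).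
  by apply/funext => w; rewrite walk_shift.
apply: discrete_rv_comp; apply: discrete_rv_pair => //; exact: (walk_incr_rv cw).
Qed.

(** Outcomes with one of the first [n] increments outside {1, -1} lie in no cylinder; they form a
    null set. *)
Definition cylinder n (c : config N n) : set T :=
  [set w | X 0%N w = c.1 /\
    forall i, (i < n)%N -> zeta i.+1 w = sgn_of (nth false c.2 i)].

(** Indexed as in [walk_independent]: 0 for the start, a positive [i] for [zeta i]. *)
Let slice n (c : config N n) (i : nat) : set T :=
  if i is i'.+1 then zeta i @^-1` [set sgn_of (nth false c.2 i')]
  else X 0%N @^-1` [set c.1].

Let cylinderE n (c : config N n) :
  cylinder c = \bigcap_(i in [set j | j \in iota 0 n.+1]) slice c i.
Proof.
apply/seteqP; split=> [w [w0 wi] [|i] //=|w H].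
  by rewrite inE mem_iota add1n ltnS => /wi.
split; first by apply: (H 0%N); rewrite /= inE.
by move=> i ilt; apply: (H i.+1); rewrite /= inE mem_iota add1n ltnS.
Qed.

Let measurable_slice n (c : config N n) i : measurable (slice c i).
Proof.
case: i => [|i]; first exact: (walk_start_rv cw).
exact: (walk_incr_rv cw).
Qed.

Lemma measurable_cylinder n (c : config N n) : measurable (cylinder c).
Proof.
rewrite cylinderE; apply: fin_bigcap_measurable => [|i _].
  exact: finite_seq.
exact: measurable_slice.
Qed.

Lemma pr_cylinder n (c : config N n) :
  pr P (cylinder c) = (N * 2 ^ n)%:R^-1.
Proof.
rewrite cylinderE (walk_independent cw) ?iota_uniq //; last first.
  by case=> [|i] _; eexists; reflexivity.
rewrite /= big_cons /= (walk_start_uniform cw).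
rewrite (eq_big_seq (fun=> 2^-1)) => [|[|i]]; last 2 first.
- by rewrite mem_iota.
- move=> _ /=; case: (nth _ _ _); first exact: (walk_incr_up cw).
  exact: (walk_incr_down cw).
by rewrite big_const_seq count_predT size_iota iter_mulr_1 natrM natrX invfM exprVn.
Qed.

Lemma trivIset_cylinder n : trivIset setT (@cylinder n).
Proof.
apply/trivIsetP => -[x e] [y f] _ _ /eqP xy; apply/seteqP; split=> // w /=.
move=> [[/= wx we] [/= wy wf]]; apply: xy; congr pair; first by rewrite -wx.
apply/val_inj/(@eq_from_nth _ false) => [|i]; first by rewrite !size_tuple.
rewrite size_tuple => ilt; have := we i ilt; rewrite (wf i ilt).
by do 2!case: (nth _ _ _).
Qed.

Lemma pr_configs n (A : set T) (Q : pred (config N n)) : measurable A ->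
  (forall c w, cylinder c w -> A w <-> Q c) ->
  pr P A = #|Q|%:R / (N * 2 ^ n)%:R.
Proof.
move=> mA AQ; rewrite -(card_config N n).
apply: (pr_uniform_partition (F := @cylinder n)) => //.
- by rewrite card_config muln_gt0 cycle_walk_size_gt0 expn_gt0.
- exact: measurable_cylinder.
- exact: trivIset_cylinder.
- by move=> c; rewrite pr_cylinder card_config.
Qed.

Lemma measurable_cylinders n : measurable (\bigcup_(c : config N n) cylinder c).
Proof.
apply: fin_bigcup_measurable => [|c _]; first exact: finite_finset.
exact: measurable_cylinder.
Qed.

Lemma pr_cylinders n : pr P (\bigcup_(c : config N n) cylinder c) = 1.
Proof.
rewrite (pr_configs (n := n) (Q := predT)); last 2 first.
- exact: measurable_cylinders.
- by move=> c w cyl; split=> // _; exists c.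
rewrite -(card_config N n) divff // pnatr_eq0 card_config muln_eq0 expn_eq0 /=.
by rewrite orbF -lt0n cycle_walk_size_gt0.
Qed.

End cycle_walk_law.

(** * Paths on cylinders and the strict minimum event *)

Section paths.
Context {R : realType} {d : measure_display} {T : measurableType d}.
Variables (P : probability T R) (N : nat).
Variables (zeta : nat -> T -> int) (X : nat -> T -> 'I_N).
Hypothesis cw : cycle_walk P zeta X.

Lemma walk_cylinder n (c : config N n) w j :
  cylinder zeta X c w -> (j <= n)%N -> X j w = config_path c j.
Proof.
move=> [w0 wi]; elim: j => [|j IH] jn.
  by rewrite /config_path psum0 cycle_shift0.
by rewrite (walk_shift cw) IH ?(ltnW jn) // wi // config_pathS.
Qed.

Lemma sum_cylinder n (c : config N n) w j :
  cylinder zeta X c w -> (j <= n)%N ->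
  \sum_(1 <= i < j.+1) zeta i w = psum c.2 j.
Proof.
move=> [_ wi] jn; rewrite big_add1 big_mkord /psum; apply: eq_bigr => i _ /=.
by rewrite wi // (leq_trans (ltn_ord i)).
Qed.

Definition far_from_0b k (x : 'I_N) : bool := (k < x)%N && (k < N - x)%N.

Lemma far_from_0P k (x : 'I_N) : reflect (far_from_0 k x) (far_from_0b k x).
Proof. exact: andP. Qed.

Lemma positive_cylinder k (c : config N k) w : cylinder zeta X c w ->
  positive_partial_sums k (fun i => zeta i w) <-> all_pos k c.2.
Proof.
move=> cyl; split=> [H|/all_posP H j jk].
  by apply/all_posP => j jk; rewrite -(sum_cylinder cyl); [exact: H|lia].
by rewrite (sum_cylinder cyl); [exact: H|lia].
Qed.

Lemma strict_min_cylinder k (c : config N k) w : cylinder zeta X c w ->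
  far_from_0 k (X 0%N w) ->
  strict_min_at_0 k (fun i => X i w) <-> all_pos k c.2.
Proof.
move=> cyl; have c0 : X 0%N w = c.1 by case: cyl.
rewrite c0 => -[k0 kN].
(* within k steps the walk does not wrap around *)
have Xj j : (j <= k)%N -> (X j w)%:Z = c.1%:Z + psum c.2 j.
  move=> jk; rewrite (walk_cylinder cyl jk) cycle_shiftE modz_small //.
  by have := psum_norm_le c.2 j; lia.
split=> [H|/all_posP H j jk].
  apply/all_posP => j jk; have := H j jk; rewrite c0 -ltz_nat Xj ?ltrDl //.
  by case/andP: jk.
rewrite c0 -ltz_nat Xj ?ltrDl; first exact: H.
by case/andP: jk.
Qed.

(** The exceptional null set is the complement of the cylinders; on a cylinder both conditions
    become [all_pos]. *)
Lemma strict_min_iff_positive k :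
  {ae P, forall w, far_from_0 k (X 0%N w) ->
    (strict_min_at_0 k (fun i => X i w) <->
     positive_partial_sums k (fun i => zeta i w))}.
Proof.
pose U := \bigcup_(c : config N k) cylinder zeta X c.
have mU : measurable U by exact: measurable_cylinders cw _.
exists (~` U); split.
- exact: measurableC.
- by rewrite -pr_fin ?pr_setC ?(pr_cylinders cw) ?subrr //; exact: measurableC.
- move=> w /= nw [c _ cyl]; apply: nw => far.
  by rewrite (strict_min_cylinder cyl far) (positive_cylinder cyl).
Qed.

Lemma measurable_far k : measurable [set w | far_from_0 k (X 0%N w)].
Proof. exact: (walk_start_rv cw [set x | far_from_0 k x]). Qed.

Lemma measurable_strict_min k :
  measurable [set w | strict_min_at_0 k (fun i => X i w)].
Proof.
have -> : [set w | strict_min_at_0 k (fun i => X i w)] =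
    \bigcap_(j in [set j | (0 < j <= k)%N]) [set w | (X 0%N w < X j w)%N].
  by [].
apply: bigcap_measurableType => j _.
have cN : countable [set: 'I_N] by exact: countableP.
exact: (discrete_rv_pair cN (discrete_rv_walk cw 0) (discrete_rv_walk cw j)
  [set p : 'I_N * 'I_N | (p.1 < p.2)%N]).
Qed.

Lemma discrete_rv_partial_sum j :
  discrete_rv (fun w => \sum_(1 <= i < j.+1) zeta i w).
Proof.
elim: j => [|j IH].
  have -> : (fun w => \sum_(1 <= i < 1) zeta i w) = cst 0.
    by apply/funext => w; rewrite big_geq.
  by move=> A; rewrite preimage_cst; case: ifP.
have -> : (fun w => \sum_(1 <= i < j.+2) zeta i w) =
    (fun p => p.1 + p.2) \o
    (fun w => (\sum_(1 <= i < j.+1) zeta i w, zeta j.+1 w)).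
  by apply/funext => w /=; rewrite big_nat_recr.
apply: discrete_rv_comp; apply: discrete_rv_pair => //.
  exact: (@countableP int).
exact: (walk_incr_rv cw).
Qed.

Lemma measurable_positive k :
  measurable [set w | positive_partial_sums k (fun i => zeta i w)].
Proof.
have -> : [set w | positive_partial_sums k (fun i => zeta i w)] =
    \bigcap_(j in [set j | (0 < j <= k)%N])
      [set w | 0 < \sum_(1 <= i < j.+1) zeta i w].
  by [].
apply: bigcap_measurableType => j _.
exact: (@discrete_rv_partial_sum j [set z | 0 < z]).
Qed.

Lemma pr_far k :
  pr P [set w | far_from_0 k (X 0%N w)] = #|far_from_0b k|%:R / N%:R.
Proof.
rewrite (pr_configs cw (n := 0) (Q := [predX far_from_0b k & predT])).
- by rewrite cardX card_tuple !expn0 !muln1.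
- exact: measurable_far.
- by move=> c w [w0 _]; rewrite !inE andbT /= w0; split=> /far_from_0P.
Qed.

(** At most 2k+1 residues are within distance k of 0; the injection [f] exhibits the others. *)
Lemma card_far k : (N <= #|far_from_0b k| + k.*2.+1)%N.
Proof.
have lt_f (i : 'I_(N - k.*2.+1)) : (k.+1 + i < N)%N by have := ltn_ord i; lia.
pose f i := Ordinal (lt_f i).
have f_inj : injective f.
  by move=> i j /(congr1 val) /= /eqP; rewrite eqn_add2l => /eqP /val_inj.
rewrite addnC -leq_subLR -[leqLHS]card_ord -(card_codom f_inj).
apply: subset_leq_card; apply/fintype.subsetP => _ /codomP[i ->].
by rewrite unfold_in /=; have := ltn_ord i; lia.
Qed.

Definition count_pos k := #|[pred e : k.-tuple bool | all_pos k e]|.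

(** Being far constrains only the start and positivity only the signs, so the favourable
    configurations form a product set. *)
Lemma pr_strict_min_far_count k :
  pr P ([set w | strict_min_at_0 k (fun i => X i w)] `&`
        [set w | far_from_0 k (X 0%N w)]) =
  pr P [set w | far_from_0 k (X 0%N w)] * ((count_pos k)%:R / 2 ^+ k).
Proof.
rewrite (pr_configs cw
  (Q := [predX far_from_0b k & [pred e : k.-tuple bool | all_pos k e]])).
- by rewrite cardX pr_far !natrM natrX invfM mulrACA.
- by apply: measurableI; [exact: measurable_strict_min|exact: measurable_far].
- move=> c w cyl; rewrite !inE; have c0 : X 0%N w = c.1 by case: cyl.
  split=> [[/= sm far]|/andP[/far_from_0P far pos]].
    by apply/andP; split; [apply/far_from_0P; rewrite -c0|rewrite -(strict_min_cylinder cyl far)].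
  by rewrite -c0 in far; split=> //=; rewrite (strict_min_cylinder cyl far).
Qed.

Lemma pr_positive_far_count k :
  pr P ([set w | positive_partial_sums k (fun i => zeta i w)] `&`
        [set w | far_from_0 k (X 0%N w)]) =
  pr P [set w | far_from_0 k (X 0%N w)] * ((count_pos k)%:R / 2 ^+ k).
Proof.
rewrite (pr_configs cw
  (Q := [predX far_from_0b k & [pred e : k.-tuple bool | all_pos k e]])).
- by rewrite cardX pr_far !natrM natrX invfM mulrACA.
- by apply: measurableI; [exact: measurable_positive|exact: measurable_far].
- move=> c w cyl; rewrite !inE; have c0 : X 0%N w = c.1 by case: cyl.
  split=> [[/= /(positive_cylinder cyl) pos far]|/andP[/far_from_0P far pos]].
    by apply/andP; split=> //; apply/far_from_0P; rewrite -c0.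
  by rewrite -c0 in far; split=> //=; apply/(positive_cylinder cyl).
Qed.

End paths.

Lemma count_pos_ballot (R : realType) m :
  (count_pos m.+1.*2)%:R / 2 ^+ m.+1.*2 = ballot_pr m.+1.*2 :> R.
Proof.
have SE : count_pos m.+1.*2 = (\sum_(e : m.+1.*2.-tuple bool) all_pos m.+1.*2 e)%N.
  by rewrite /count_pos -sum1_card big_mkcond.
rewrite /ballot_pr doubleK -count_all_pos -SE -[(count_pos _).*2]muln2 natrM.
by rewrite exprS; field; rewrite expf_neq0 // pnatr_eq0.
Qed.

(** The bound on the number of indices is 1, and index 0 always counts itself, so no other index may
    count. *)
Lemma outlier_strict_min (R : realType) (k N : nat) (x : nat -> 'I_N) :
  outlier (k.+1%:R^-1 : R) (fun i : 'I_k.+1 => value_label (x i)) <->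
  strict_min_at_0 k x.
Proof.
rewrite /outlier mulVf ?pnatr_eq0 // lern1.
split=> [/fintype.card_le1_eqP H j /andP[j0 jk]|H].
  rewrite ltnNge; apply/negP => xj.
  have /(congr1 val) /= : Ordinal (jk : (j < k.+1)%N) = ord0.
    by apply: H; rewrite inE /value_label /= ler_nat.
  by lia.
apply/fintype.card_le1_eqP.
suff A i : i \in [pred i : 'I_k.+1 | (value_label (x i) : R) <= value_label (x (@ord0 k))] -> i = ord0.
  by move=> i j /A -> /A ->.
rewrite inE /value_label /= ler_nat => le_x; apply/val_inj/eqP => /=.
rewrite -leqn0 leqNgt; apply/negP => i0.
have := H i; rewrite i0 -ltnS ltn_ord => /(_ isT); lia.
Qed.

(** * Markov property and reversibility *)

Lemma psum_rcons s b j : (j <= size s)%N -> psum (rcons s b) j = psum s j.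
Proof.
move=> js; apply: eq_bigr => i _; rewrite nth_rcons.
by rewrite (leq_trans (ltn_ord i) js).
Qed.

Lemma sum_config_rcons N n (F : config N n.+1 -> nat) :
  (\sum_c F c = \sum_(c : config N n) \sum_b F (c.1, rcons_tuple c.2 b))%N.
Proof.
rewrite pair_big /= (reindex (fun p : config N n * bool =>
  ((p.1.1, rcons_tuple p.1.2 p.2) : config N n.+1))) //.
apply/onW_bij/inj_card_bij => [[[x e] b] [[y f] b'] /= []|].
  by move=> -> /rcons_inj [/val_inj -> ->].
by rewrite !card_prod !card_ord !card_tuple card_bool expnSr mulnA.
Qed.

Section window_reversal.
Variables (N i k : nat).

(** Steps before time [i] are kept; those of the window come in reverse order and negated, since
    running backwards undoes each step. *)
Definition reverse_steps (e : (i + k).-tuple bool) : (i + k).-tuple bool :=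
  [tuple if (l < i)%N then nth false e l
         else ~~ nth false e (i + (k - (l - i).+1)) | l < i + k].

Lemma nth_reverse_steps (e : (i + k).-tuple bool) l : (l < i + k)%N ->
  nth false (reverse_steps e) l =
  if (l < i)%N then nth false e l else ~~ nth false e (i + (k - (l - i).+1)).
Proof.
by move=> lt; rewrite -(tnth_nth _ _ (Ordinal lt)) tnth_mktuple.
Qed.

Lemma reverse_stepsK : involutive reverse_steps.
Proof.
move=> e; apply/val_inj/(@eq_from_nth _ false) => [|l]; first by rewrite !size_tuple.
rewrite size_tuple => lt; rewrite nth_reverse_steps //.
case: ltnP => il; first by rewrite nth_reverse_steps // il.
rewrite nth_reverse_steps; last by lia.
rewrite ltnNge leq_addr /= negbK; congr nth; lia.
Qed.

Lemma psum_reverse_steps_prefix (e : (i + k).-tuple bool) :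
  psum (reverse_steps e) i = psum e i.
Proof.
apply: eq_bigr => l _; have := ltn_ord l => li.
by rewrite nth_reverse_steps ?li // (leq_trans li) ?leq_addr.
Qed.

Lemma psum_reverse_steps (e : (i + k).-tuple bool) j : (j <= k)%N ->
  psum (reverse_steps e) (i + j) =
  psum e i + psum e (i + (k - j)) - psum e (i + k).
Proof.
elim: j => [|j IH] jk.
  by rewrite addn0 subn0 psum_reverse_steps_prefix addrK.
rewrite addnS psumS IH ?(ltnW jk) // nth_reverse_steps ?ltn_add2l //.
rewrite ltnNge leq_addr /= addKn.
rewrite (_ : (k - j = (k - j.+1).+1)%N); last lia.
rewrite addnS psumS; case: nth; rewrite /sgn_of /=; lia.
Qed.

(* The shift of the starting point makes the new path be at time i where the
   old one is at time i + k. *)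
Definition reverse_config (c : config N (i + k)) : config N (i + k) :=
  (cycle_shift c.1 (psum c.2 (i + k) - psum c.2 i), reverse_steps c.2).

Lemma reverse_configK : involutive reverse_config.
Proof.
move=> [x e]; rewrite /reverse_config /= reverse_stepsK; congr pair.
rewrite cycle_shiftD psum_reverse_steps_prefix psum_reverse_steps // subnn addn0.
rewrite -[RHS]cycle_shift0; congr cycle_shift; lia.
Qed.

Lemma config_path_reverse (c : config N (i + k)) j : (j <= k)%N ->
  config_path (reverse_config c) (i + j) = config_path c (i + (k - j)).
Proof.
move=> jk; rewrite /config_path cycle_shiftD psum_reverse_steps //.
congr cycle_shift; rewrite /=; ring.
Qed.

End window_reversal.

Section markov.
Context {R : realType} {d : measure_display} {T : measurableType d}.
Variables (P : probability T R) (N : nat).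
Variables (zeta : nat -> T -> int) (X : nat -> T -> 'I_N).
Hypothesis cw : cycle_walk P zeta X.

(** Counting signs also covers [N] equal to 1 or 2, where both signs lead to the same state. *)
Definition cycle_kernel (x y : 'I_N) : R :=
  (\sum_b (cycle_shift x (sgn_of b) == y))%N%:R / 2.

Lemma cycle_kernel_ge0 x y : 0 <= cycle_kernel x y.
Proof. by rewrite divr_ge0. Qed.

Lemma cycle_kernel_sum1 x : \sum_y cycle_kernel x y = 1.
Proof.
rewrite -mulr_suml -natr_sum exchange_big /= big_bool /=.
have one z : (\sum_y (z == y) = 1 :> nat)%N.
  by rewrite (bigD1 z) //= eqxx big1 // => y /negbTE; rewrite eq_sym => ->.
by rewrite !one divff // pnatr_eq0.
Qed.

(** Shifts are invertible, so the columns sum to 1 as well; this makes the uniform law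
    stationary. *)
Lemma cycle_kernel_sum1_l y : \sum_x cycle_kernel x y = 1.
Proof.
rewrite -mulr_suml -natr_sum exchange_big /= big_bool /=.
have one z : (\sum_x (cycle_shift x z == y) = 1 :> nat)%N.
  under eq_bigr do rewrite cycle_shift_eq.
  by rewrite (bigD1 (cycle_shift y (- z))) //= eqxx big1 // => x /negbTE ->.
by rewrite !one divff // pnatr_eq0.
Qed.

Lemma measurable_path_event n s : measurable (path_event X n s).
Proof.
have -> : path_event X n s =
    \bigcap_(i in [set i | (i <= n)%N]) [set w | X i w = s i] by [].
apply: bigcap_measurableType => i _.
exact: (discrete_rv_walk cw i [set s i]).
Qed.

Lemma cycle_walk_markov_step n (s : nat -> 'I_N) y :
  0 < pr P (path_event X n s) ->
  cond_pr P [set w | X n.+1 w = y] (path_event X n s) = cycle_kernel (s n) y.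
Proof.
pose Q m (c : config N m) := [forall i : 'I_n.+1, config_path c i == s i].
have QP m (c : config N m) w : cylinder zeta X c w -> (n <= m)%N ->
    path_event X n s w <-> Q m c.
  move=> cyl nm; split=> [H|/forallP H i ilt].
    apply/forallP => i; have ilt : (i <= n)%N by rewrite -ltnS.
    by rewrite -(walk_cylinder cw cyl (leq_trans ilt nm)) H.
  rewrite (walk_cylinder cw cyl (leq_trans ilt nm)).
  exact/eqP/(H (Ordinal (ilt : (i < n.+1)%N))).
have mpath := measurable_path_event n s.
have mX : measurable [set w | X n.+1 w = y].
  exact: (discrete_rv_walk cw n.+1 [set y]).
rewrite /cond_pr (pr_configs cw (n := n) (Q := Q n)) //; last first.
  by move=> c w cyl; exact: QP.
rewrite (pr_configs cw (n := n.+1)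
  (Q := fun c => Q n.+1 c && (config_path c n.+1 == y))); last 2 first.
- exact: measurableI.
- move=> c w cyl; split=> [[/= Xy path]|/andP[Qc /eqP Xy]].
    apply/andP; split; first exact/(QP _ c w).
    by rewrite -(walk_cylinder cw cyl) ?Xy.
  by split; [rewrite /= (walk_cylinder cw cyl)|exact/(QP _ c w)].
(* A configuration following [s] up to time [n] is extended by one sign, and the number of signs
   leading to [y] depends on [s n] alone. *)
have -> : #|[pred c | Q n.+1 c && (config_path c n.+1 == y)]| =
    (#|Q n| * \sum_b (cycle_shift (s n) (sgn_of b) == y))%N.
  rewrite -sum1_card big_mkcond sum_config_rcons -sum1_card big_distrl /=.
  rewrite [RHS]big_mkcond; apply: eq_bigr => c _.
  have pathE b i : (i <= n)%N ->
      config_path ((c.1, rcons_tuple c.2 b) : config N n.+1) i = config_path c i.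
    by move=> ilt; rewrite /config_path /= psum_rcons // size_tuple.
  have QE b : Q n.+1 (c.1, rcons_tuple c.2 b) = Q n c.
    by apply: eq_forallb => i; rewrite pathE // -ltnS.
  rewrite [c \in _](_ : _ = Q n c) //; case: ifP => Qc; last first.
    by rewrite big1 // => b _; rewrite unfold_in /= QE Qc.
  have /eqP cs : config_path c n == s n by have /forallP/(_ ord_max) := Qc.
  rewrite mul1n; apply: eq_bigr => b _; rewrite unfold_in /= QE Qc /=.
  rewrite config_pathS pathE // cs /= nth_rcons size_tuple ltnn eqxx.
  by case: eqP.
rewrite expnS mulnCA !natrM => pos.
have Q0 : #|Q n|%:R != 0 :> R.
  by apply: contraTneq pos => ->; rewrite mul0r ltxx.
have N0 : N%:R != 0 :> R by rewrite pnatr_eq0 -lt0n (cycle_walk_size_gt0 cw).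
rewrite /cycle_kernel natrX; field.
by rewrite Q0 N0 expf_neq0 // pnatr_eq0.
Qed.

Lemma cycle_walk_stationary : stationary_chain P X.
Proof.
have N0 : N%:R != 0 :> R by rewrite pnatr_eq0 -lt0n (cycle_walk_size_gt0 cw).
exists cycle_kernel; split.
- exact: (discrete_rv_walk cw).
- exact: cycle_kernel_ge0.
- exact: cycle_kernel_sum1.
- exact: cycle_walk_markov_step.
- by move=> x; exact: pr_ge0.
- under eq_bigr do rewrite (walk_start_uniform cw).
  by rewrite sumr_const card_ord -[_ *+ _]mulr_natr mulVf.
- move=> y; under eq_bigr do rewrite (walk_start_uniform cw).
  by rewrite (walk_start_uniform cw) -mulr_sumr cycle_kernel_sum1_l mulr1.
Qed.

Lemma measurable_walk_tuple m (f : nat -> nat) (A : set (m.-tuple 'I_N)) :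
  measurable [set w | A [tuple X (f j) w | j < m]].
Proof.
have -> : [set w | A [tuple X (f j) w | j < m]] =
    \bigcup_(t in A) \bigcap_(j in [set: 'I_m]) [set w | X (f j) w = tnth t j].
  apply/seteqP; split=> [w Aw|w [t At H] /=].
    by exists [tuple X (f j) w | j < m] => // j _ /=; rewrite tnth_mktuple.
  rewrite (_ : mktuple _ = t) //; apply: eq_from_tnth => j.
  by rewrite tnth_mktuple; exact: H.
apply: fin_bigcup_measurable => [|t _]; first exact: finite_finset.
apply: fin_bigcap_measurable => [|j _]; first exact: finite_finset.
exact: (discrete_rv_walk cw (f j) [set tnth t j]).
Qed.

Lemma cycle_walk_reversible : reversible P X.
Proof.
move=> i k A.
(* With [f] either the identity or [k - j], one count serves both sides. *)
pose Q (f : nat -> nat) (c : config N (i + k)) :=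
  `[< A [tuple config_path c (i + f j) | j < k.+1] >].
have prE (f : nat -> nat) : (forall j, (j <= k)%N -> (f j <= k)%N) ->
    P [set w | A [tuple X (i + f j)%N w | j < k.+1]] =
    (#|Q f|%:R / (N * 2 ^ (i + k))%:R)%:E.
  move=> fk; have mA := measurable_walk_tuple (fun j => i + f j)%N A.
  rewrite -pr_fin // (pr_configs cw (Q := Q f)) // => c w cyl.
  rewrite /= (_ : mktuple _ = [tuple config_path c (i + f j) | j < k.+1]).
    by split; move/asboolP.
  apply: eq_from_tnth => j; rewrite !tnth_mktuple (walk_cylinder cw cyl) //.
  by rewrite leq_add2l fk // -ltnS.
rewrite (prE id) // (prE (fun j => k - j)%N) => [|j _]; last exact: leq_subr.
congr (_%:R / _)%:E.
rewrite -!sum1_card (reindex_inj (inv_inj (@reverse_configK N i k))) /=.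
apply: eq_bigl => c; rewrite !unfold_in /Q; congr (`[< A _ >]).
by apply: eq_from_tnth => j; rewrite !tnth_mktuple config_path_reverse // -ltnS.
Qed.

End markov.

(** * A walk built from the digits of a uniform variable *)

Section uniform_cells.
Variable R : realType.

Let P : probability _ R := uniform_prob (@ltr01 R).

(** For [w] in [0, 1), the index of the interval [m/k, (m+1)/k) containing [w]. The sample space is
    all of [R], but the mass sits on [0, 1]. *)
Definition cell (k : nat) (w : R) : nat := `|Num.floor (k%:R * w)|%N.

Lemma floor_cell (k : nat) (m : int) : (0 < k)%N ->
  [set w : R | Num.floor (k%:R * w) = m] =
  [set` `[m%:~R / k%:R, (m + 1)%:~R / k%:R[%R].
Proof.
move=> k0; have k0' : 0 < k%:R :> R by rewrite ltr0n.
apply/seteqP; split=> w /=; rewrite in_itv /= ler_pdivrMr // ltr_pdivlMr //.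
  by move=> <-; rewrite mulrC; exact: floor_itv.
by rewrite mulrC -floor_ge_int -floor_lt_int ltzD1 -eq_le => /eqP.
Qed.

Lemma discrete_rv_cell (k : nat) : (0 < k)%N -> discrete_rv (cell k).
Proof.
move=> k0; rewrite /cell.
have -> : (fun w : R => `|Num.floor (k%:R * w)|%N) =
  absz \o (fun w : R => Num.floor (k%:R * w)) by [].
apply: discrete_rv_comp => A.
have -> : (fun w : R => Num.floor (k%:R * w)) @^-1` A =
    \bigcup_(z : int) [set w : R | A z /\ Num.floor (k%:R * w) = z].
  apply/seteqP; split=> [w Aw|w [z _ [Az e]]]; last by rewrite /= e.
  by exists (Num.floor (k%:R * w)).
apply: countable_bigcupT_measurable; first exact: (@countableP int).
move=> z; have [Az|nAz] := pselect (A z).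
  rewrite (_ : [set w : R | _] = [set w : R | Num.floor (k%:R * w) = z]).
    by rewrite floor_cell //; exact: measurable_itv.
  by apply/seteqP; split=> w //= [].
rewrite (_ : [set w : R | _] = set0); first exact: measurable0.
by apply/seteqP; split=> w //= [].
Qed.

Lemma uniform_itvco (a b : R) : 0 <= a -> a <= b -> b <= 1 ->
  pr P [set` `[a, b[%R] = b - a.
Proof.
move=> a0 ab b1; rewrite /pr.
have -> : P [set` `[a, b[%R] =
  (\int[lebesgue_measure]_(x in [set` `[a, b[%R]) (uniform_pdf 0 1 x)%:E)%E by [].
rewrite (eq_integral (fun=> 1%:E)) => [|w]; last first.
  rewrite inE /= in_itv /= => /andP[aw wb].
  by rewrite /uniform_pdf subr0 invr1 (le_trans a0 aw) (le_trans (ltW wb) b1).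
rewrite integral_cst ?mul1e /=; last exact: measurable_itv.
rewrite lebesgue_measure_itv /= lte_fin; case: ltP => [_|ba] //=.
by rewrite (le_anti (_ : a <= b <= a)) ?subrr // ab.
Qed.

Lemma pr_floor_partition (k : nat) (A : set R) (Q : pred nat) :
  (0 < k)%N -> measurable A ->
  (forall (m : nat) w, Num.floor (k%:R * w) = m%:Z -> A w <-> Q m) ->
  pr P A = (\sum_(m < k) Q m)%N%:R / k%:R.
Proof.
move=> k0 mA AQ; have k0' : 0 < k%:R :> R by rewrite ltr0n.
pose Q' : pred 'I_k := fun m => Q m.
have -> : (\sum_(m < k) Q m)%N = #|Q'|.
  rewrite -sum1_card [RHS]big_mkcond; apply: eq_bigr => m _.
  by rewrite unfold_in /Q'; case: (Q m).
rewrite -[in k%:R](card_ord k).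
apply: (@pr_uniform_partition R _ _ P 'I_k
  (fun m : 'I_k => [set w : R | Num.floor (k%:R * w) = m%:Z]) A Q') => //.
- by rewrite card_ord.
- by move=> m; rewrite floor_cell //; exact: measurable_itv.
- apply/trivIsetP => m m' _ _ mm'; apply/seteqP; split=> // w [/= -> [e]].
  by move/eqP: mm'; apply; exact/val_inj.
- move=> m; rewrite floor_cell // uniform_itvco.
  + by rewrite -mulrBl intrD addrC addKr card_ord mul1r.
  + by rewrite divr_ge0 // ltW.
  + by rewrite ler_pM2r ?invr_gt0 // ler_int; lia.
  + rewrite ler_pdivrMr // mul1r (_ : (m%:Z + 1)%R = m.+1%:Z); last lia.
    by rewrite ler_nat.
- by move=> m w /AQ.
Qed.

Lemma pr_cell (k : nat) (Q : pred nat) : (0 < k)%N ->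
  pr P [set w | Q (cell k w)] = (\sum_(m < k) Q m)%N%:R / k%:R.
Proof.
move=> k0; apply: pr_floor_partition => //.
  exact: (discrete_rv_cell k0 [set m | Q m]).
by move=> m w e; rewrite /= /cell e absz_nat.
Qed.

(* The hypothesis is on the floor because cell takes absolute values: it
   excludes the negative w. *)
Lemma cell_div (k l m : nat) (w : R) : (0 < k)%N -> (0 < l)%N ->
  Num.floor ((k * l)%:R * w) = m%:Z -> cell k w = (m %/ l)%N.
Proof.
move=> k0 l0 /eqP; have l0' : 0 < l%:R :> R by rewrite ltr0n.
rewrite eq_le -ltzD1 floor_lt_int floor_ge_int => /andP[ub lb].
rewrite /cell (_ : Num.floor (k%:R * w) = (m %/ l)%N%:Z) ?absz_nat //.
apply/eqP; rewrite eq_le -ltzD1 floor_lt_int floor_ge_int.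
have succ_intr q : (q%:Z + 1)%:~R = q.+1%:R :> R.
  by rewrite intrD -natr1.
rewrite natrM mulrAC in lb ub.
apply/andP; split; [rewrite -(ltr_pM2r l0')|rewrite -(ler_pM2r l0')].
  apply: lt_le_trans ub _.
  by rewrite !succ_intr -natrM ler_nat; apply: ltn_ceil.
apply: le_trans _ lb.
by rewrite -!pmulrn -natrM ler_nat leq_trunc_div.
Qed.

Lemma sum_ord_double (G : nat -> nat) k :
  (\sum_(m < k * 2) G m = \sum_(m < k) (G m.*2 + G m.*2.+1))%N.
Proof.
elim: k => [|k IH]; first by rewrite !big_ord0.
by rewrite mulSn addnC addn2 !big_ord_recr /= IH -muln2 addnA.
Qed.

Section digits.
Variable N : nat.
Hypothesis N0 : (0 < N)%N.

Definition digits (i : nat) (w : R) : nat := cell (N * 2 ^ i) w.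

Let size_gt0 i : (0 < N * 2 ^ i)%N.
Proof. by rewrite muln_gt0 N0 expn_gt0. Qed.

(** [digits n] determines the earlier ones by division by powers of 2. A condition at a positive
    index sees only the parity, which is the new binary digit, so the number of admissible cells is
    multiplicative. *)
Lemma pr_digits_prefix (C : nat -> pred nat) n :
  (forall i m, C i.+1 m = C i.+1 (odd m)) ->
  pr P [set w | forall i, (i <= n)%N -> C i (digits i w)] =
  \prod_(i < n.+1) pr P [set w | C i (digits i w)].
Proof.
move=> Codd.
pose Q n m := all (fun i => C i (m %/ 2 ^ (n - i))%N) (iota 0 n.+1).
pose c n := (\sum_(m < N * 2 ^ n) Q n m)%N.
have prE k : pr P [set w | forall i, (i <= k)%N -> C i (digits i w)] =
    (c k)%:R / (N * 2 ^ k)%:R.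
  apply: pr_floor_partition => //.
    have -> : [set w | forall i, (i <= k)%N -> C i (digits i w)] =
        \bigcap_(i in [set i | (i <= k)%N]) [set w | C i (digits i w)].
      by [].
    apply: bigcap_measurableType => i _.
    exact: (discrete_rv_cell (size_gt0 i) [set m | C i m]).
  move=> m w e /=.
  have dE i : (i <= k)%N -> digits i w = (m %/ 2 ^ (k - i))%N.
    move=> ik; apply: cell_div => //; first by rewrite expn_gt0.
    by rewrite -mulnA -expnD subnKC.
  split=> [H|/allP H i ik]; last first.
    by rewrite dE //; apply: H; rewrite mem_iota.
  by apply/allP => i; rewrite mem_iota add0n ltnS => /andP[_ ik]; rewrite -dE // H.
have QS k m b : (b < 2)%N ->
    Q k.+1 (m * 2 + b)%N = Q k m && C k.+1 (m * 2 + b)%N.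
  move=> b2; rewrite /Q -[k.+2]addn1 iotaD all_cat [X in _ && X]/= andbT add0n subnn expn0 divn1.
  congr andb; apply: eq_in_all => i; rewrite mem_iota add0n ltnS => /andP[_ ik].
  by rewrite subSn // expnS divnMA divnMDl // (divn_small b2) addn0.
(* The number of values of the new binary digit that the condition at [k.+1] admits. *)
pose e k := (C k.+1 0 + C k.+1 1)%N.
have CE k m : (C k.+1 m.*2 + C k.+1 m.*2.+1)%N = e k.
  by rewrite Codd [X in (_ + nat_of_bool X)%N]Codd /= odd_double.
have cS k : c k.+1 = (c k * e k)%N.
  rewrite /c expnSr mulnA (sum_ord_double (fun m => Q k.+1 m)) big_distrl; apply: eq_bigr => m _ /=.
  have := QS k m 0%N isT; have := QS k m 1%N isT.
  rewrite addn0 addn1 muln2 => -> ->.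
  by rewrite -(CE k m); case: (Q k m); rewrite ?mul1n ?mul0n.
have dS k : (\sum_(m < N * 2 ^ k.+1) C k.+1 m)%N = (N * 2 ^ k * e k)%N.
  rewrite expnSr mulnA (sum_ord_double (fun m => C k.+1 m)); under eq_bigr do rewrite CE.
  by rewrite sum_nat_const card_ord.
elim: n => [|n IH].
  rewrite big_ord1; congr pr; apply/seteqP.
  by split=> w /= H; [exact: H|move=> i; rewrite leqn0 => /eqP ->].
rewrite big_ord_recr /= -IH !prE cS [X in _ = _ * X]pr_cell // dS.
rewrite expnSr mulnA !natrM; field.
by rewrite !pnatr_eq0 -!lt0n expn_gt0 N0.
Qed.

Lemma pr_bigcap_digits (C : nat -> pred nat) (s : seq nat) : uniq s ->
  (forall i m, i.+1 \in s -> C i.+1 m = C i.+1 (odd m)) ->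
  pr P (\bigcap_(i in [set j | j \in s]) [set w | C i (digits i w)]) =
  \prod_(i <- s) pr P [set w | C i (digits i w)].
Proof.
move=> us Codd; pose n := (\max_(i <- s) i)%N.
have sn i : i \in s -> (i <= n)%N by move=> si; apply: leq_bigmax_seq.
(* Trivial conditions outside [s] turn the finite family into a full prefix. *)
pose C' i m := (i \in s) ==> C i m.
have C'odd i m : C' i.+1 m = C' i.+1 (odd m).
  by rewrite /C'; case: (boolP (_ \in s)) => //= /Codd.
have := pr_digits_prefix n C'odd; rewrite -(big_mkord xpredT (fun i => pr P [set w | C' i (digits i w)])).
rewrite (_ : [set w | forall i, _ -> _] =
  \bigcap_(i in [set j | j \in s]) [set w | C i (digits i w)]); last first.
  apply/seteqP; split=> w /= H i => [si|_].
    by have := H i (sn i si); rewrite /C' si.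
  by apply/implyP => si; exact: H.
move=> ->.
rewrite (bigID (fun i => i \in s)) /= [X in _ * X]big1 ?mulr1; last first.
  move=> i /negbTE si; rewrite /C' si /= -(pr_setT P); congr pr.
  by apply/seteqP.
rewrite -big_filter (perm_big s); last first.
  apply: uniq_perm => [||i]; [exact/filter_uniq/iota_uniq|by []|].
  by rewrite mem_filter mem_index_iota /= ltnS; case: (boolP (i \in s)) => //= /sn ->.
by apply: eq_big_seq => i si; rewrite /C' si.
Qed.

(** For [w] outside [0, 1) the index may be out of range; the start is then 0. *)
Definition digit_start (w : R) : 'I_N := insubd (Ordinal N0) (digits 0 w).

Definition digit_step (i : nat) (w : R) : int := sgn_of (odd (digits i w)).

Fixpoint digit_walk (n : nat) (w : R) : 'I_N :=
  if n is n'.+1 then cycle_shift (digit_walk n' w) (digit_step n'.+1 w)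
  else digit_start w.

Lemma discrete_rv_digits i : discrete_rv (digits i).
Proof. exact: discrete_rv_cell. Qed.

Let pr_odd_digit (b : bool) i :
  pr P [set w | odd (digits i.+1 w) == b] = 2^-1.
Proof.
rewrite (pr_cell (fun m => odd m == b)) // expnSr mulnA.
rewrite (sum_ord_double (fun m => odd m == b)).
rewrite (eq_bigr (fun=> 1%N)) => [|m _]; last by rewrite /= odd_double; case: b.
rewrite sum_nat_const card_ord muln1 [(_ * 2)%:R]natrM invfM mulrA divff ?mul1r //.
by rewrite pnatr_eq0 -lt0n.
Qed.

Lemma digit_walk_cycle_walk : cycle_walk P digit_step digit_walk.
Proof.
split.
- exact: (discrete_rv_comp (insubd (Ordinal N0)) (discrete_rv_digits 0)).
- move=> i _.
  exact: (discrete_rv_comp (fun m => sgn_of (odd m)) (discrete_rv_digits i)).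
- move=> x.
  have -> : [set w | digit_walk 0 w = x] =
      [set w | insubd (Ordinal N0) (digits 0 w) == x].
    by apply/seteqP; split=> w /= /eqP.
  rewrite (pr_cell (fun m => insubd (Ordinal N0) m == x)) // expn0 muln1.
  under eq_bigr do rewrite valKd.
  by rewrite (bigD1 x) //= eqxx big1 ?div1r // => m /negbTE ->.
- case=> // i _; rewrite -(pr_odd_digit true i); congr pr; apply/seteqP.
  by split=> w /=; rewrite /digit_step; case: odd.
- case=> // i _; rewrite -(pr_odd_digit false i); congr pr; apply/seteqP.
  by split=> w /=; rewrite /digit_step; case: odd.
- move=> s E us sE.
  (* Each event is a condition on one digit, and for a sign a condition on its parity. *)
  have : forall i, exists c : pred nat, i \in s ->
      E i = [set w | c (digits i w)] /\ ((0 < i)%N -> forall m, c m = c (odd m)).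
    move=> i; have [si|] := boolP (i \in s); last by exists xpredT.
    have := sE i si; case: i si => [|i] si [B EB].
      exists (fun m => `[< B (insubd (Ordinal N0) m) >]) => _; split=> //.
      by rewrite EB; apply/seteqP; split=> w /=; move/asboolP.
    exists (fun m => `[< B (sgn_of (odd m)) >]) => _; split.
      by rewrite EB; apply/seteqP; split=> w /=; move/asboolP.
    by move=> _ m; rewrite oddb.
  move/choice => [C HC].
  have -> : \bigcap_(i in [set j | j \in s]) E i =
      \bigcap_(i in [set j | j \in s]) [set w | C i (digits i w)].
    by apply: eq_bigcapr => i /HC [].
  rewrite pr_bigcap_digits // => [|i m /HC [_ H]]; last exact: H.
  by apply: eq_big_seq => i /HC [->].
- by move=> i w; rewrite /= cycle_shiftE.
Qed.

End digits.

End uniform_cells.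

(** * Existence, far starts and the outlier probability *)

Lemma cycle_walk_exists (R : realType) (N : nat) : (0 < N)%N ->
  exists (d : measure_display) (T : measurableType d) (P : probability T R)
    (zeta : nat -> T -> int) (X : nat -> T -> 'I_N), cycle_walk P zeta X.
Proof. by move=> N0; do 5!eexists; exact: (digit_walk_cycle_walk R N0). Qed.

Lemma far_from_0_likely (R : realType) (k : nat) (delta : R) : 0 < delta ->
  exists N0 : nat, forall N : nat, (N0 <= N)%N ->
  forall (d : measure_display) (T : measurableType d)
    (P : probability T R) (zeta : nat -> T -> int) (X : nat -> T -> 'I_N),
  cycle_walk P zeta X -> 1 - delta < pr P [set w | far_from_0 k (X 0%N w)].
Proof.
(* At most 2k+1 of the [N] starts are close to 0, a fraction below [delta] once N > (2k+1)/delta. *)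
move=> d0; exists (Num.trunc (k.*2.+1%:R / delta)).+1 => N leN d T P zeta X cw.
have N0 : 0 < N%:R :> R by rewrite ltr0n (cycle_walk_size_gt0 cw).
rewrite (pr_far cw) ltr_pdivlMr //.
have card : N%:R <= #|@far_from_0b N k|%:R + k.*2.+1%:R :> R.
  by rewrite -natrD ler_nat; exact: card_far.
have : k.*2.+1%:R < delta * N%:R.
  rewrite mulrC -ltr_pdivrMr //; apply: lt_le_trans (truncnS_gt _) _.
  by rewrite ler_nat.
lra.
Qed.

Lemma even_half_succ k : (0 < k)%N -> ~~ odd k -> exists m, k = m.+1.*2.
Proof. by move=> k0 ko; exists k./2.-1; lia. Qed.

Section outlier_probability.
Context {R : realType} {d : measure_display} {T : measurableType d}.
Variables (P : probability T R) (N : nat).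
Variables (zeta : nat -> T -> int) (X : nat -> T -> 'I_N).
Hypothesis cw : cycle_walk P zeta X.

Lemma cond_pr_ballot k : (0 < k)%N -> ~~ odd k ->
  0 < pr P [set w | far_from_0 k (X 0%N w)] ->
  cond_pr P [set w | strict_min_at_0 k (fun i => X i w)]
            [set w | far_from_0 k (X 0%N w)] = ballot_pr k /\
  cond_pr P [set w | positive_partial_sums k (fun i => zeta i w)]
            [set w | far_from_0 k (X 0%N w)] = ballot_pr k.
Proof.
move=> k0 /(even_half_succ k0) [m ->] far0.
rewrite /cond_pr (pr_strict_min_far_count cw) (pr_positive_far_count cw).
by rewrite count_pos_ballot mulrC mulKf // gt_eqF.
Qed.

Lemma outlierE k :
  [set w | outlier (k.+1%:R^-1 : R)
             (fun i : 'I_k.+1 => value_label (X i w))] =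
  [set w | strict_min_at_0 k (fun i => X i w)].
Proof.
apply/funext => w; apply/propext.
exact: (outlier_strict_min R k (fun i => X i w)).
Qed.

Lemma pr_outlier_ge k : (0 < k)%N -> ~~ odd k ->
  pr P [set w | far_from_0 k (X 0%N w)] * ballot_pr k <=
  pr P [set w | outlier (k.+1%:R^-1 : R)
                  (fun i : 'I_k.+1 => value_label (X i w))].
Proof.
move=> k0 /(even_half_succ k0) [m ->].
rewrite outlierE -count_pos_ballot -(pr_strict_min_far_count cw).
have mS := measurable_strict_min cw m.+1.*2.
by apply: le_pr => //; apply: measurableI => //; exact: measurable_far cw _.
Qed.

End outlier_probability.

Lemma outlier_likely (R : realType) (k : nat) : (0 < k)%N -> ~~ odd k ->
  exists N0 : nat, forall N : nat, (N0 <= N)%N ->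
  forall (d : measure_display) (T : measurableType d)
    (P : probability T R) (zeta : nat -> T -> int) (X : nat -> T -> 'I_N),
  cycle_walk P zeta X ->
  let eps : R := k.+1%:R^-1 in
  Num.sqrt (eps / (2 * pi)) <=
    pr P [set w | outlier eps (fun i : 'I_k.+1 => value_label (X i w))].
Proof.
move=> k0 ko; set s : R := Num.sqrt (k.+1%:R^-1 / (2 * pi)).
have sb : s < ballot_pr k.
  by have [m km] := even_half_succ k0 ko; rewrite /s km; exact: ballot_pr_gt_sqrt.
have b0 : 0 < ballot_pr k :> R by apply: le_lt_trans (sqrtr_ge0 _) sb.
(* This [delta] gives the far event probability above [s / ballot_pr k], so its product with
   [ballot_pr k] exceeds [s]; it is positive because [sb] is strict. *)
have [|N0 HN0] := @far_from_0_likely R k (1 - s / ballot_pr k).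
  by rewrite subr_gt0 ltr_pdivrMr ?mul1r.
exists N0 => N leN d T P zeta X cw /=.
apply: le_trans (pr_outlier_ge cw k0 ko).
have := HN0 N leN d T P zeta X cw.
by rewrite subKr ltr_pdivrMr // => /ltW.
Qed.

Theorem mainTheorem2 (R : realType) :
  (* the walk exists, for every N *)
  (forall N : nat, (0 < N)%N ->
    exists (d : measure_display) (T : measurableType d) (P : probability T R)
      (zeta : nat -> T -> int) (X : nat -> T -> 'I_N),
      cycle_walk P zeta X)
  /\
  (* it is a stationary reversible Markov chain *)
  (forall (N : nat) (d : measure_display) (T : measurableType d)
      (P : probability T R) (zeta : nat -> T -> int) (X : nat -> T -> 'I_N),
    cycle_walk P zeta X -> stationary_reversible_chain P X)
  /\
  (* X_0 is far from 0 with probability close to 1 when N is large *)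
  (forall (k : nat) (delta : R), 0 < delta ->
    exists N0 : nat, forall N : nat, (N0 <= N)%N ->
    forall (d : measure_display) (T : measurableType d)
      (P : probability T R) (zeta : nat -> T -> int) (X : nat -> T -> 'I_N),
    cycle_walk P zeta X ->
    1 - delta < pr P [set w | far_from_0 k (X 0%N w)])
  /\
  (* on that event, being the strict minimum amounts to positive sums *)
  (forall (k N : nat) (d : measure_display) (T : measurableType d)
      (P : probability T R) (zeta : nat -> T -> int) (X : nat -> T -> 'I_N),
    cycle_walk P zeta X ->
    {ae P, forall w, far_from_0 k (X 0%N w) ->
      (strict_min_at_0 k (fun i => X i w) <->
       positive_partial_sums k (fun i => zeta i w))})
  /\
  (* the conditional probability of this, for k even *)
  (forall (k N : nat) (d : measure_display) (T : measurableType d)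
      (P : probability T R) (zeta : nat -> T -> int) (X : nat -> T -> 'I_N),
    (0 < k)%N -> ~~ odd k ->
    cycle_walk P zeta X ->
    0 < pr P [set w | far_from_0 k (X 0%N w)] ->
    cond_pr P [set w | strict_min_at_0 k (fun i => X i w)]
              [set w | far_from_0 k (X 0%N w)] = ballot_pr k
    /\
    cond_pr P [set w | positive_partial_sums k (fun i => zeta i w)]
              [set w | far_from_0 k (X 0%N w)] = ballot_pr k)
  /\
  (* its asymptotics along the even integers k = 2 m *)
  ((fun m : nat => ballot_pr m.*2 / (Num.sqrt (2 * pi * m.*2%:R))^-1)
     @ \oo --> (1 : R))
  /\
  (* being the strict minimum amounts to being a 1/(k+1)-outlier *)
  (forall (k N : nat) (x : nat -> 'I_N),
    outlier (k.+1%:R^-1 : R) (fun i : 'I_k.+1 => value_label (x i)) <->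
    strict_min_at_0 k x)
  /\
  (* the probability of being an outlier in this example *)
  (forall k : nat, (0 < k)%N -> ~~ odd k ->
    exists N0 : nat, forall N : nat, (N0 <= N)%N ->
    forall (d : measure_display) (T : measurableType d)
      (P : probability T R) (zeta : nat -> T -> int) (X : nat -> T -> 'I_N),
    cycle_walk P zeta X ->
    let eps : R := k.+1%:R^-1 in
    Num.sqrt (eps / (2 * pi)) <=
      pr P [set w | outlier eps
                      (fun i : 'I_k.+1 => value_label (X i w))])
  /\
  (* hence it can be as high as sqrt (eps / (2 pi)) for such chains *)
  (forall k : nat, (0 < k)%N -> ~~ odd k ->
    exists (d : measure_display) (T : measurableType d) (P : probability T R)
      (S : finType) (X : nat -> T -> S) (label : S -> R),
    stationary_reversible_chain P X /\
    let eps : R := k.+1%:R^-1 in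
    Num.sqrt (eps / (2 * pi)) <=
      pr P [set w | outlier eps (fun i : 'I_k.+1 => label (X i w))]).
Proof.
split; first exact: cycle_walk_exists.
split=> [N d T P zeta X cw|].
  by split; [exact: cycle_walk_stationary cw|exact: cycle_walk_reversible cw].
split; first exact: far_from_0_likely.
split=> [k N d T P zeta X cw|]; first exact: strict_min_iff_positive.
split=> [k N d T P zeta X k0 ko cw|]; first exact: (cond_pr_ballot cw).
split; first exact: ballot_pr_sim.
split; first exact: outlier_strict_min.
split; first exact: outlier_likely.
move=> k k0 ko; have [N0 HN0] := outlier_likely R k0 ko.
have [d [T [P [zeta [X cw]]]]] := cycle_walk_exists R (ltn0Sn N0).
exists d, T, P, 'I_N0.+1, X, (@value_label R N0.+1); split; last first.
  exact: HN0 (leqnSn N0) _ _ _ _ _ cw.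
by split; [exact: cycle_walk_stationary cw|exact: cycle_walk_reversible cw].
Qed.
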